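(* Let $\vec\omega:I\to\mathbb R^3$ be a differentiable vector-valued function on an interval $I\subseteq\mathbb R$ containing $0$, put $\vec\omega_0=\vec\omega(0)$, and let $\omega_*>0$, $\vec r_0,\vec v_0\in\mathbb R^3$. The solution of the Cauchy problem $$\ddot{\vec r}+2\vec\omega\times\dot{\vec r}+\vec\omega\times(\vec\omega\times\vec r)+\dot{\vec\omega}\times\vec r+\omega_*^2\vec r=\vec 0,\qquad \vec r(0)=\vec r_0,\quad\dot{\vec r}(0)=\vec v_0,$$ is given by the vector-valued function $$\vec r=F_{-\omega}\!\left(\vec r_0\cos\omega_*t+\frac{\vec v_0+\vec\omega_0\times\vec r_0}{\omega_*}\sin\omega_*t\right).$$
   Context: Vectors are in oriented Euclidean three-space; the dot denotes $d/dt$. $\widetilde\omega(t)$ is the skew-symmetric $3\times3$ matrix with $\widetilde\omega(t)\vec x=\vec\omega(t)\times\vec x$. The rotation tensor with angular velocity $-\vec\omega$ is $F_{-\omega}(\vec x)(t)=Q(t)\vec x(t)$, where $Q$ is the unique solution of $\dot Q=-\widetilde\omega Q$, $Q(0)=I_3$. *)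

(* Defs.v *)
From mathcomp Require Import all_boot all_order all_algebra.
From mathcomp Require Import all_classical all_reals all_analysis.

Set Implicit Arguments.
Unset Strict Implicit.
Unset Printing Implicit Defensive.

Import Order.TTheory GRing.Theory Num.Theory.
Import numFieldNormedType.Exports.

Local Open Scope classical_set_scope.
Local Open Scope ring_scope.

(** Differentiation relative to a set [I]: the difference quotient at [t] is
    taken only along points of [I], so the derivative is one-sided at an
    endpoint of an interval [I] that belongs to [I], and the usual one in the
    interior.  For [t] in [I], only the values of [f] on [I] matter. *)
Section DeriveOn.
Variables (R : realType) (V : normedModType R) (I : set R).

Definition diff_quot_on (f : R -> V) (t : R) :=
  (s - t)^-1 *: (f s - f t) @[s --> within I t^'].

Definition derivable_on (f : R -> V) (t : R) : Prop := cvg (diff_quot_on f t).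

Definition derive_on (f : R -> V) (t : R) : V := lim (diff_quot_on f t).

End DeriveOn.

Section RotatingFrame.
Variable R : realType.
Implicit Types (u v x : 'cV[R]_3) (I : set R) (w : R -> 'cV[R]_3).

(** Indices are added modulo 3 in ['I_3]. *)
Definition crossv u v : 'cV[R]_3 :=
  \col_(k < 3) (u (k + 1) 0 * v (k + 2%:R) 0 - u (k + 2%:R) 0 * v (k + 1) 0).

(** The matrix of [crossv u] in the canonical basis; see [skew_mxE]. *)
Definition skew_mx u : 'M[R]_3 :=
  \matrix_(i < 3, j < 3) crossv u (delta_mx j 0) i 0.

Lemma skew_mxE u x : skew_mx u *m x = crossv u x.
Proof.
have sumE (a b : 'I_3) :
    \sum_j u a 0 * (b == j)%:R * x j 0 = u a 0 * x b 0.
  rewrite (bigD1 b) //= eqxx mulr1 big1 ?addr0 // => j /negPf.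
  by rewrite eq_sym => ->; rewrite mulr0 mul0r.
apply/colP => i; rewrite !mxE -!sumE -sumrB.
by apply: eq_bigr => j _; rewrite !mxE !andbT mulrBl.
Qed.

Lemma skew_mx_tr u : (skew_mx u)^T = - skew_mx u.
Proof.
apply/matrixP; case=> [[|[|[|//]]] i3]; case=> [[|[|[|//]]] j3];
  rewrite !mxE /= !(mulr0, mulr1, subr0, sub0r) ?oppr0 ?opprK //;
  try congr (- _); congr (fun_of_matrix _ _ _); exact: val_inj.
Qed.

(** [Q' = u~ Q] on [I] and [Q 0 = 1]: [Q] is the rotation with angular velocity
    [u].  On an interval containing [0] this determines [Q] on [I] only. *)
Definition is_rotation I (u : R -> 'cV[R]_3) (Q : R -> 'M[R]_3) : Prop :=
  Q 0 = 1%:M /\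
  forall t, I t ->
    derivable_on I Q t /\ derive_on I Q t = skew_mx (u t) *m Q t.

(** The solution [Q] is selected by choice; the default [fun=> 0] would only be
    used if there were none. *)
Definition rotation I (u : R -> 'cV[R]_3) : R -> 'M[R]_3 :=
  xget (fun=> 0) [set Q | is_rotation I u Q].

Definition rotation_tensor I (u x : R -> 'cV[R]_3) : R -> 'cV[R]_3 :=
  fun t => rotation I u t *m x t.

Definition cauchy_solution I w (wstar : R) (r0 v0 : 'cV[R]_3)
    (r : R -> 'cV[R]_3) : Prop :=
  let w' := derive_on I w in
  let r' := derive_on I r in
  let r'' := derive_on I r' in
  [/\ forall t, I t -> derivable_on I r t,
      forall t, I t -> derivable_on I r' t,
      forall t, I t ->
        r'' t + 2%:R *: crossv (w t) (r' t)
        + crossv (w t) (crossv (w t) (r t))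
        + crossv (w' t) (r t) + wstar ^+ 2 *: r t = 0,
      r 0 = r0
    & r' 0 = v0].

End RotatingFrame.

(* Main.v *)
Require Import Defs.
From mathcomp Require Import all_boot all_order all_algebra.
From mathcomp Require Import all_classical all_reals all_analysis.
From mathcomp Require Import ring lra.

Set Implicit Arguments.
Unset Strict Implicit.
Unset Printing Implicit Defensive.

Import Order.TTheory GRing.Theory Num.Theory.
Import numFieldNormedType.Exports.

Local Open Scope classical_set_scope.
Local Open Scope ring_scope.

(** Let [Q] be the rotation with angular velocity [- w] and [W t] the skew
    matrix of [w t], so that [Q' = - W Q].  Seen from the frame at
    rest, the motion is [y = Q^T r], and the inertial terms disappear: with
    [y1 = Q^T (r' + W r)] one has [y' = y1], because [(Q^T)' = Q^T W], and
    [y1' = Q^T (r'' + 2 W r' + W W r + W' r)].  So [r] solves the Cauchy problem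
    exactly when [y] solves the harmonic equation [y'' = - wstar^2 y] with
    [y 0 = r0] and [y' 0 = v0 + crossv (w 0) r0].  That equation has only the
    stated solution ([harmonic_oscillator_unique]), and [r = Q y] since [Q] is
    orthogonal ([rotation_orthogonal]).  Conversely [r = Q x], with [x] the
    harmonic motion, is differentiated twice by the product rule
    ([has_derive_on_mulmx]).

    [Q] is a choice among the solutions of a linear differential equation, so
    the substance is that this equation has a solution on the whole interval
    [I], whatever its shape.  Because [w] is differentiable it is continuous on
    [I], and [linear_ode_exists] solves [X' = A X] for continuous [A] by
    Picard's series: its terms are iterated primitives
    ([has_derive_on_primitive]), a comparison with exponentials bounds them by
    a geometric series on each segment ([picard_term_le_exp]), and the sum
    satisfies the integral equation ([picard_sum_fixpoint]).  Derivatives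
    relative to [I] are compared through the mean value theorem on segments
    ([has_derive_on_norm_le]). *)

(** * Derivatives relative to a set *)

Lemma near_within_dnbhsP (T : topologicalType) (I P : set T) (t : T) :
  (\forall s \near within I t^', P s) <->
  (\forall s \near t, I s -> s != t -> P s).
Proof.
by split=> h; move: h; rewrite /dnbhs !near_withinE; apply: filterS => s h;
  [move=> Is st; exact: h|move=> st Is; exact: h].
Qed.

Lemma within_dnbhs_cvg (T : topologicalType) (I : set T) (t : T) :
  within I t^' `=>` within I (nbhs t).
Proof.
move=> P; rewrite {1}/within /= => tP; apply/near_within_dnbhsP.
by apply: filterS tP => s h Is _; exact: h.
Qed.

Lemma within_dnbhs_cvg_id (T : topologicalType) (I : set T) (t : T) :
  within I t^' --> t.
Proof.
by move=> A tA; apply/near_within_dnbhsP; apply: filterS tA => s As _ _.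
Qed.

Lemma cvg_mxP (R : realType) (T : Type) (F : set_system T) {FF : Filter F}
    (m n : nat) (f : T -> 'M[R]_(m, n)) (l : 'M[R]_(m, n)) :
  f @ F --> l <-> forall i j, f x i j @[x --> F] --> l i j.
Proof.
split=> [fl i j|fl].
  apply: (cvg_comp _ (fun M : 'M[R]_(m, n) => M i j) fl).
  exact: coord_continuous.
move=> A [P lP PA]; rewrite /nbhs /=.
have : \forall x \near F, forall ij : 'I_m * 'I_n, P ij.1 ij.2 (f x ij.1 ij.2).
  by apply: filter_forall => -[i j]; exact: (fl i j) (lP i j).
by apply: filterS => x Px; apply: PA => i j; exact: (Px (i, j)).
Qed.

Lemma cvg_mulmx (R : realType) (T : Type) (F : set_system T) {FF : Filter F}
    (m n p : nat) (A : T -> 'M[R]_(m, n)) (B : T -> 'M[R]_(n, p))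
    (a : 'M[R]_(m, n)) (b : 'M[R]_(n, p)) :
  A @ F --> a -> B @ F --> b -> A x *m B x @[x --> F] --> a *m b.
Proof.
move=> /cvg_mxP Aa /cvg_mxP Bb; apply/cvg_mxP => i j; rewrite mxE.
under eq_fun do rewrite mxE.
by apply: cvg_big => [|k _]; [exact: add_continuous|exact: cvgM].
Qed.

Section RelativeDerivative.
Variable R : realType.
Implicit Types (I J : set R) (t : R).

Definition has_derive_on (V : normedModType R) I (f : R -> V) t (l : V) :=
  diff_quot_on I f t --> l.

Section Normed.
Variable V : normedModType R.
Implicit Types f g : R -> V.

(** Off [t], [f s = (s - t) *: q s + f t] with [q] the difference quotient; the
    point [t] itself is then put back. *)
Lemma has_derive_on_cont I f t l :
  has_derive_on I f t l -> f @ within I (nbhs t) --> f t.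
Proof.
move=> fl.
have st : (s - t) @[s --> within I t^'] --> (0 : R).
  rewrite -(subrr t); apply: cvgB; last exact: cvg_cst.
  exact: within_dnbhs_cvg_id.
have fd : f @ within I t^' --> f t.
  have : (s - t) *: ((s - t)^-1 *: (f s - f t)) + f t @[s --> within I t^']
      --> 0 *: l + f t.
    by apply: cvgD; [exact: cvgZ|exact: cvg_cst].
  rewrite scale0r add0r; apply: cvg_trans; apply: near_eq_cvg.
  apply/near_within_dnbhsP; near=> s => _ s_t.
  by rewrite /= scalerA divff ?subr_eq0// scale1r subrK.
move=> A fA; have /near_within_dnbhsP := fd A fA.
rewrite /= !near_simpl near_withinE; apply: filterS => s h Is.
by have [->|s_t] := eqVneq s t; [exact: nbhs_singleton|exact: h].
Unshelve. all: by end_near. Qed.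

Lemma has_derive_on_near_eq I f g t l : I t ->
  (\forall s \near within I (nbhs t), f s = g s) ->
  has_derive_on I g t l -> has_derive_on I f t l.
Proof.
move=> It fg; apply: cvg_trans; apply: near_eq_cvg.
have ft : f t = g t by move: fg; rewrite near_withinE => /nbhs_singleton; exact.
apply/near_within_dnbhsP; rewrite near_withinE in fg.
by apply: filterS fg => s fg Is _; rewrite ft (fg Is).
Qed.

Lemma has_derive_on_eq I f g t l : I t -> (forall s, I s -> f s = g s) ->
  has_derive_on I g t l -> has_derive_on I f t l.
Proof.
move=> It fg; apply: has_derive_on_near_eq => //.
by rewrite near_withinE; apply: filterE => s; exact: fg.
Qed.

Lemma has_derive_on_sub I J f t l : J `<=` I ->
  has_derive_on I f t l -> has_derive_on J f t l.
Proof.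
move=> JI; rewrite /has_derive_on /diff_quot_on; apply: cvg_trans.
by apply: cvg_fmap2; exact: within_subset.
Qed.

Lemma has_derive_on_cst I (a : V) t : has_derive_on I (fun=> a) t 0.
Proof.
rewrite /has_derive_on /diff_quot_on.
by under eq_fun do rewrite subrr scaler0; exact: cvg_cst.
Qed.

Lemma has_derive_onD I f g t l k : has_derive_on I f t l ->
  has_derive_on I g t k -> has_derive_on I (fun s => f s + g s) t (l + k).
Proof.
move=> fl gk; rewrite /has_derive_on /diff_quot_on.
under eq_fun do rewrite opprD addrACA scalerDr.
exact: cvgD.
Qed.

Lemma has_derive_on_cstD I f (c : V) t l :
  has_derive_on I f t l -> has_derive_on I (fun s => c + f s) t l.
Proof.
move=> fl; rewrite -[l]add0r; apply: has_derive_onD => //.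
exact: has_derive_on_cst.
Qed.

Lemma has_derive_onN I f t l :
  has_derive_on I f t l -> has_derive_on I (fun s => - f s) t (- l).
Proof.
move=> fl; rewrite /has_derive_on /diff_quot_on.
under eq_fun do rewrite -opprD scalerN.
exact: cvgN.
Qed.

Lemma has_derive_onB I f g t l k : has_derive_on I f t l ->
  has_derive_on I g t k -> has_derive_on I (fun s => f s - g s) t (l - k).
Proof. by move=> fl /has_derive_onN; exact: has_derive_onD. Qed.

(** The increment of the product is split as
    [(a s - a t) *: f s + a t *: (f s - f t)], so the first term also needs the
    continuity of [f]. *)
Lemma has_derive_onZ I (a : R -> R) f t (a' : R) l :
  has_derive_on I (a : R -> R^o) t a' -> has_derive_on I f t l ->
  has_derive_on I (fun s => a s *: f s) t (a' *: f t + a t *: l).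
Proof.
move=> aa' fl; rewrite /has_derive_on /diff_quot_on.
have -> : (fun s => (s - t)^-1 *: (a s *: f s - a t *: f t)) =
    (fun s => ((s - t)^-1 *: (a s - a t) : R) *: f s +
              a t *: ((s - t)^-1 *: (f s - f t))).
  apply/funext => s; set k := (s - t)^-1.
  rewrite (_ : k *: (_ : R) *: f s = k *: ((a s - a t) *: f s)); last first.
    by rewrite scalerA.
  rewrite [a t *: (k *: _)]scalerA [a t * k]mulrC -scalerA -scalerDr.
  by congr (_ *: _); rewrite scalerBl scalerBr addrA subrK.
apply: cvgD; apply: cvgZ => //; last exact: cvg_cst.
apply: cvg_trans (has_derive_on_cont fl); apply: cvg_fmap2.
exact: within_dnbhs_cvg.
Qed.

Lemma has_derive_on_sum I (n : nat) (f : nat -> R -> V) (l : nat -> V) t :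
  (forall k, has_derive_on I (f k) t (l k)) ->
  has_derive_on I (fun s => \sum_(0 <= k < n) f k s) t (\sum_(0 <= k < n) l k).
Proof.
move=> fl; elim: n => [|n IHn].
  by under [fun _ => _]eq_fun do rewrite big_nil;
    rewrite big_nil; exact: has_derive_on_cst.
under [fun _ => _]eq_fun do rewrite big_nat_recr//=; rewrite big_nat_recr//=.
exact: has_derive_onD.
Qed.

End Normed.

Section Matrix.

Lemma has_derive_on_mxP I (m n : nat) (A : R -> 'M[R]_(m, n)) t A' :
  has_derive_on I A t A' <->
  forall i j, has_derive_on I (fun s => A s i j : R^o) t (A' i j).
Proof.
rewrite /has_derive_on /diff_quot_on; split=> [/cvg_mxP h i j|h].
  by have := h i j; under eq_fun do rewrite !mxE.
by apply/cvg_mxP => i j; under eq_fun do rewrite !mxE; exact: h.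
Qed.

Lemma has_derive_on_mulmx I (m n p : nat) (A : R -> 'M[R]_(m, n))
    (B : R -> 'M[R]_(n, p)) t A' B' :
  has_derive_on I A t A' -> has_derive_on I B t B' ->
  has_derive_on I (fun s => A s *m B s) t (A' *m B t + A t *m B').
Proof.
move=> AA' BB'; rewrite /has_derive_on /diff_quot_on.
have -> : (fun s => (s - t)^-1 *: (A s *m B s - A t *m B t)) =
    (fun s => ((s - t)^-1 *: (A s - A t)) *m B s +
              A t *m ((s - t)^-1 *: (B s - B t))).
  apply/funext => s; rewrite -scalemxAl -scalemxAr -scalerDr.
  by congr (_ *: _); rewrite mulmxBl mulmxBr addrA subrK.
apply: cvgD; apply: cvg_mulmx => //; last exact: cvg_cst.
apply: cvg_trans (has_derive_on_cont BB'); apply: cvg_fmap2.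
exact: within_dnbhs_cvg.
Qed.

Lemma has_derive_on_tr I (m n : nat) (A : R -> 'M[R]_(m, n)) t A' :
  has_derive_on I A t A' -> has_derive_on I (fun s => (A s)^T) t A'^T.
Proof.
move=> /has_derive_on_mxP h; apply/has_derive_on_mxP => i j; rewrite mxE.
by under [fun _ => _]eq_fun do rewrite mxE; exact: h.
Qed.

End Matrix.

(** Caratheodory's criterion turns the library derivative, written with
    increments at 0, into a limit of difference quotients at [t]. *)
Lemma is_derive_has_derive_on I (f : R -> R) t l :
  is_derive t 1 f l -> has_derive_on I (f : R -> R^o) t l.
Proof.
move=> /is_derive1_caratheodory[g [fg gt gl]].
have : g @ within I t^' --> l.
  rewrite -gl; apply: cvg_trans gt; apply: cvg_fmap2.
  exact: within_dnbhs_cvg_id.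
apply: cvg_trans; apply: near_eq_cvg; apply/near_within_dnbhsP.
near=> s => _ s_t; rewrite fg /GRing.scale /= mulrC mulfK// subr_eq0//.
Unshelve. all: by end_near. Qed.

Lemma has_derive_on_is_derive I (f : R -> R) t l : nbhs t I ->
  has_derive_on I (f : R -> R^o) t l -> is_derive t 1 f l.
Proof.
move=> tI fl; apply/is_derive1_caratheodory.
exists (fun s => if s == t then l else (f s - f t) / (s - t)); split.
- move=> s; case: eqVneq => [->|s_t]; first by rewrite !subrr mulr0.
  by rewrite divfK// subr_eq0.
- apply/continuous_withinNx; rewrite eqxx.
  move=> A /fl; rewrite /= !near_simpl => /near_within_dnbhsP h.
  rewrite /dnbhs near_withinE; apply: filterS2 tI h => s Is h s_t.
  by rewrite (negPf s_t) mulrC; exact: h.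
- by rewrite eqxx.
Qed.

End RelativeDerivative.

Arguments has_derive_on_cst {R V} I a t.

(** * Mean value inequalities *)

Section MeanValue.
Variable R : realType.

(** An interval with a second point [u] contains points arbitrarily close to
    [t] on the side of [u]; hence relative derivatives are unique. *)
Lemma dnbhs_within_proper (I : set R) (t : R) :
  is_interval I -> I t -> (exists2 u, I u & u != t) ->
  ProperFilter (within I t^').
Proof.
move=> itvI It [u Iu]; rewrite neq_lt => ut.
apply: Build_ProperFilter_ex => P /near_within_dnbhsP/nbhs_ballP[e /= e0 eP].
have e20 : 0 < e / 2 by rewrite divr_gt0.
have e2e : e / 2 < e by rewrite ltr_pdivrMr// ltr_pMr// ltr1n.
have [ut'|tu] := orP ut.
- exists (Num.max u (t - e / 2)); apply: eP.
  + rewrite /ball /= ger0_norm ?subr_ge0 ?ge_max ?(ltW ut')//=; last first.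
      by rewrite gerBl ltW.
    by rewrite ltrBlDr -ltrBlDl lt_max ltrD2l ltrN2 e2e orbT.
  + apply: (itvI u t) => //; rewrite le_max lexx ge_max (ltW ut')/=.
    by rewrite gerBl ltW.
  + by rewrite lt_eqF// gt_max ut' /= ltrBlDr ltrDl.
- exists (Num.min u (t + e / 2)); apply: eP.
  + rewrite /ball /= ler0_norm ?subr_le0 ?le_min ?(ltW tu)//=; last first.
      by rewrite lerDl ltW.
    by rewrite opprB ltrBlDl gt_min ltrD2l e2e orbT.
  + apply: (itvI t u) => //; rewrite le_min ge_min lexx (ltW tu)/= andbT.
    by rewrite lerDl ltW.
  + by rewrite gt_eqF// lt_min tu /= ltrDl.
Qed.

Lemma has_derive_on_val (V : normedModType R) (I : set R) (f : R -> V) t l :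
  ProperFilter (within I t^') -> has_derive_on I f t l ->
  derivable_on I f t /\ derive_on I f t = l.
Proof.
by move=> pI fl; split; [apply/cvg_ex; exists l|apply: cvg_lim].
Qed.

(** The mean value theorem applied to [g - f], whose derivative is
    nonnegative. *)
Lemma has_derive_on_ler (f g : R -> R) (f' g' : R -> R) (a b : R) : a <= b ->
  (forall s, `[a, b]%classic s ->
    has_derive_on `[a, b] (f : R -> R^o) s (f' s)) ->
  (forall s, `[a, b]%classic s ->
    has_derive_on `[a, b] (g : R -> R^o) s (g' s)) ->
  (forall s, `[a, b]%classic s -> f' s <= g' s) ->
  f b - f a <= g b - g a.
Proof.
move=> ab ff' gg' fg'.
have dh s : `[a, b]%classic s ->
    has_derive_on `[a, b] ((fun s => g s - f s) : R -> R^o) s (g' s - f' s).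
  by move=> sab; exact: (has_derive_onB (gg' s sab) (ff' s sab)).
have [| |c cab] :=
  @MVT_segment R (fun s => g s - f s) (fun s => g' s - f' s) _ _ ab.
- move=> x; rewrite in_itv /= => /andP[ax xb].
  apply: (@has_derive_on_is_derive _ `[a, b]); last first.
    by apply: dh; rewrite /= in_itv /= !ltW.
  have : nbhs x `]a, b[%classic.
    by apply: open_nbhs_nbhs; split;
      [exact: interval_open|rewrite /= in_itv /= ax].
  exact/filterS/subset_itv_oo_cc.
- by apply/subspace_continuousP => x xab; exact: has_derive_on_cont (dh x xab).
move=> hE; rewrite -subr_ge0.
have -> : g b - g a - (f b - f a) = g b - f b - (g a - f a).
  by rewrite !opprB addrACA [RHS]addrACA [- f b + _]addrC.
rewrite hE mulr_ge0 ?subr_ge0// fg'//.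
Qed.

Lemma mx_norm_leP (m n : nat) (A : 'M[R]_(m, n)) (e : R) : 0 <= e ->
  `|A| <= e <-> forall i j, `|A i j| <= e.
Proof.
move=> e0; rewrite [`|A|]/Num.Def.normr /= mx_normrE; split=> [Ae i j|Ae].
  by apply: le_trans Ae; exact: (le_bigmax _ (fun ij => `|A ij.1 ij.2|) (i, j)).
by apply: bigmax_le => // -[i j] _; exact: Ae.
Qed.

Lemma le_mx_norm (m n : nat) (A : 'M[R]_(m, n)) i j : `|A i j| <= `|A|.
Proof. exact: (mx_norm_leP A (normr_ge0 A)).1. Qed.

Lemma mx_norm_mulmx (m n p : nat) (A : 'M[R]_(m, n)) (B : 'M[R]_(n, p)) :
  `|A *m B| <= n%:R * `|A| * `|B|.
Proof.
apply/mx_norm_leP => [|i j]; first by rewrite !mulr_ge0.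
rewrite mxE (le_trans (ler_norm_sum _ _ _))//.
have -> : n%:R * `|A| * `|B| = \sum_(k < n) `|A| * `|B|.
  by rewrite sumr_const card_ord -mulrA mulr_natl.
by apply: ler_sum => k _; rewrite normrM ler_pM// le_mx_norm.
Qed.

(** Comparing each entry and its opposite with [g] suffices, the norm being the
    largest absolute value of an entry. *)
Lemma has_derive_on_norm_le (m n : nat) (f f' : R -> 'M[R]_(m, n))
    (g g' : R -> R) (a b : R) : a <= b ->
  (forall s, `[a, b]%classic s -> has_derive_on `[a, b] f s (f' s)) ->
  (forall s, `[a, b]%classic s ->
    has_derive_on `[a, b] (g : R -> R^o) s (g' s)) ->
  (forall s, `[a, b]%classic s -> `|f' s| <= g' s) ->
  `|f b - f a| <= g b - g a.
Proof.
move=> ab ff' gg' fg'.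
have f0 : 0 <= g b - g a.
  rewrite -[leLHS](subrr 0).
  apply: (@has_derive_on_ler (fun=> 0) g (fun=> 0) g' a b) => // s sab.
    exact: has_derive_on_cst.
  by rewrite (le_trans _ (fg' _ sab)).
apply/mx_norm_leP => // i j; rewrite !mxE ler_norml lerNl; apply/andP; split.
- rewrite opprB addrC -[X in _ + X]opprK.
  apply: (@has_derive_on_ler (fun s => - f s i j) g
    (fun s => - f' s i j) g' a b) => // s sab.
    apply: (@has_derive_onN _ R^o).
    by move/has_derive_on_mxP : (ff' s sab); exact.
  rewrite (le_trans _ (fg' s sab))// (le_trans _ (le_mx_norm _ i j))//.
  by rewrite -normrN ler_norm.
- apply: (@has_derive_on_ler (fun s => f s i j) g
    (fun s => f' s i j) g' a b) => // s sab.
    by move/has_derive_on_mxP : (ff' s sab); exact.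
  rewrite (le_trans _ (fg' s sab))// (le_trans _ (le_mx_norm _ i j))//.
  exact: ler_norm.
Qed.

Lemma has_derive_on_0_cst (m n : nat) (I : set R) (f : R -> 'M[R]_(m, n)) :
  is_interval I -> (forall s, I s -> has_derive_on I f s 0) ->
  forall s t, I s -> I t -> f s = f t.
Proof.
move=> itvI f0.
suff h s t : I s -> I t -> s <= t -> f s = f t.
  by move=> s t Is It; have [st|/ltW ts] := leP s t; [exact: h|rewrite (h t s)].
move=> Is It st.
have stI : `[s, t] `<=` I.
  by move=> x; rewrite /= in_itv /= => xst; exact: (itvI s t).
apply/esym/eqP; rewrite -subr_eq0 -normr_le0 -(subrr 0).
apply: (@has_derive_on_norm_le _ _ f (fun=> 0) (fun=> 0) (fun=> 0)) => //.
- by move=> x /stI/f0; exact: has_derive_on_sub.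
- by move=> x _; exact: has_derive_on_cst.
- by move=> x _; rewrite normr0.
Qed.

End MeanValue.

(** * Primitives on an interval *)

Section Primitive.
Variable R : realType.
Notation mu := (@lebesgue_measure R).

(** Reduces local questions on an interval of any shape to a segment.  If [t] is
    not the maximum of [I], then [b] is the larger of 0 and a point of [I]
    beyond [t]; otherwise no point of [I] lies beyond [t], and [b] is the larger
    of 0 and [t].  The choice of [a] is symmetric. *)
Lemma interval_segment_nbhs (I : set R) (t : R) : is_interval I -> I 0 -> I t ->
  exists a b, [/\ a <= 0 <= b, `[a, b] `<=` I &
    \forall s \near within I (nbhs t), `[a, b]%classic s].
Proof.
move=> itvI I0 It.
have [b [b0 Ib tb]] : exists b, [/\ 0 <= b, I b &
    \forall s \near within I (nbhs t), s <= b].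
  have [[u Iu tu]|ntu] := pselect (exists2 u, I u & t < u).
    exists (Num.max 0 u); rewrite le_max lexx; split => //.
      by rewrite /Num.max; case: ifP.
    rewrite near_withinE; have : \forall s \near t, s < u by exact: lt_nbhsl.
    by apply: filterS => s su Is; rewrite le_max (ltW su) orbT.
  exists (Num.max 0 t); rewrite le_max lexx; split => //.
    by rewrite /Num.max; case: ifP.
  rewrite near_withinE; apply: filterE => s Is; rewrite le_max orbC leNgt.
  by apply/orP; left; apply/negP => ts; apply: ntu; exists s.
have [a [a0 Ia ta]] : exists a, [/\ a <= 0, I a &
    \forall s \near within I (nbhs t), a <= s].
  have [[u Iu ut]|nut] := pselect (exists2 u, I u & u < t).
    exists (Num.min 0 u); rewrite ge_min lexx; split => //.
      by rewrite /Num.min; case: ifP.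
    rewrite near_withinE; have : \forall s \near t, u < s by exact: lt_nbhsr.
    by apply: filterS => s su Is; rewrite ge_min (ltW su) orbT.
  exists (Num.min 0 t); rewrite ge_min lexx; split => //.
    by rewrite /Num.min; case: ifP.
  rewrite near_withinE; apply: filterE => s Is; rewrite ge_min orbC leNgt.
  by apply/orP; left; apply/negP => st; apply: nut; exists s.
exists a, b; split; [by rewrite a0| |].
  by move=> x; rewrite /= in_itv /= => axb; exact: (itvI a b).
by apply: filterS2 ta tb => s sa sb; rewrite /= in_itv /= sa.
Qed.

Definition primitive (f : R -> R) (t : R) : R :=
  if 0 <= t then \int[mu]_(x in `[0, t]) f x else - \int[mu]_(x in `[t, 0]) f x.

Lemma primitive0 f : primitive f 0 = 0.
Proof. by rewrite /primitive lexx set_itv1 Rintegral_set1. Qed.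

Definition clamp (a b x : R) := Num.max a (Num.min x b).

Lemma clamp_in (a b x : R) : a <= b -> `[a, b]%classic (clamp a b x).
Proof.
move=> ab; rewrite /= in_itv /= /clamp le_max lexx/= ge_max ab/= ge_min.
by rewrite lexx orbT.
Qed.

Lemma clamp_id (a b x : R) : `[a, b]%classic x -> clamp a b x = x.
Proof.
by rewrite /= in_itv /= /clamp => /andP[ax xb]; rewrite min_l// max_r.
Qed.

(** Constant prolongation of [f] beyond the ends of the segment: the fundamental
    theorem of calculus needs continuity on both sides, which may fail for
    [f] itself at an endpoint of [I]. *)
Lemma continuous_comp_clamp (f : R -> R) (a b : R) : a <= b ->
  {within `[a, b], continuous f} -> continuous (f \o clamp a b).
Proof.
move=> ab /subspace_continuousP cf x.
have cl : clamp a b @ x --> clamp a b x.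
  apply: (@continuous_max R R (fun=> a) (fun y => Num.min y b)).
    exact: cvg_cst.
  apply: (@continuous_min R R id (fun=> b)).
    exact: cvg_id.
  exact: cvg_cst.
apply: (cvg_comp (clamp a b) f _ (cf _ (clamp_in x ab))).
move=> A /cl; rewrite /= !near_simpl; apply: filterS => y; apply.
exact: clamp_in.
Qed.

(** Near [t] the primitive is [G s - G 0], where [G] integrates the prolongation
    of [f] from a point to the left of the segment; [G] is differentiable in the
    usual sense. *)
Lemma has_derive_on_primitive (I : set R) (f : R -> R) :
  is_interval I -> I 0 -> (forall t, I t -> f @ within I (nbhs t) --> f t) ->
  forall t, I t -> has_derive_on I (primitive f : R -> R^o) t (f t).
Proof.
move=> itvI I0 cf t It.
have [a [b [/andP[a0 b0] abI tab]]] := interval_segment_nbhs itvI I0 It.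
have ab := le_trans a0 b0.
have tabt : `[a, b]%classic t.
  by move: tab; rewrite near_withinE => /nbhs_singleton; exact.
have {}cf : {within `[a, b], continuous f}.
  apply/subspace_continuousP => x xab; apply: cvg_trans (cf x (abI _ xab)).
  by apply: cvg_fmap2; exact: within_subset.
pose g := f \o clamp a b; have cg := continuous_comp_clamp ab cf.
have ig (u v : R) : mu.-integrable `[u, v] (EFin \o g).
  apply: continuous_compact_integrable; first exact: segment_compact.
  exact: continuous_subspaceT.
(* The base point must lie strictly to the left of [t], which may be [a]. *)
pose G x := \int[mu]_(y in `[a - 1, x]) g y.
have GB u v : u <= v -> `[a, b]%classic u -> `[a, b]%classic v ->
    \int[mu]_(x in `[u, v]) f x = G v - G u.
  move=> uv; rewrite /= !in_itv /= => /andP[au ub] /andP[av vb].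
  have a1u : a - 1 <= u by rewrite (le_trans _ au)// gerBl.
  rewrite /G (Rintegral_itvB (ig (a - 1) v)) ?bnd_simp//.
  rewrite Rintegral_itv_obnd_cbnd; last first.
    by apply: integrableS (ig u v) => //; exact: subset_itv_oc_cc.
  apply: eq_Rintegral => x; rewrite inE /= in_itv /= => /andP[ux xv].
  by rewrite /g /= clamp_id//= in_itv /= (le_trans au)// (le_trans xv).
have dG : has_derive_on I (G : R -> R^o) t (f t).
  apply: is_derive_has_derive_on.
  have t1 : t < t + 1 by rewrite ltrDl.
  have at1 : a - 1 < t.
    move: tabt; rewrite /= in_itv /= => /andP[+ _]; apply: lt_le_trans.
    by rewrite ltrBlDr ltrDl.
  have -> : f t = g t by rewrite /g /= clamp_id.
  have [dG <-] := continuous_FTC1_closed t1 (ig _ _) at1 (cg t).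
  by rewrite derive1E; exact/derivableP.
apply: (@has_derive_on_near_eq _ R^o _ _ (fun s => G s - G 0)) => //.
  apply: filterS tab => s sab; rewrite /primitive.
  have ab0 : `[a, b]%classic 0 by rewrite /= in_itv /= a0.
  have [s0|/ltW s0] := leP 0 s; first by rewrite GB.
  by rewrite GB// opprB.
rewrite -[f t]subr0; apply: (@has_derive_onB _ R^o) => //.
exact: has_derive_on_cst.
Qed.

End Primitive.

(** * Geometrically dominated series *)

Section GeometricSeries.
Variable R : realType.

Lemma ler_geometric_vanish (x y c : R) :
  (forall N, x <= y + c * 2^-1 ^+ N) -> x <= y.
Proof.
move=> xyc; apply/ler_addgt0Pr => e e0.
have q1 : `|2^-1 : R| < 1 by rewrite gtr0_norm ?invr_gt0// invf_lt1// ltr1n.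
have /cvgr0_norm_le /(_ e e0) [N _ /(_ N (leqnn N))] := @cvg_geometric R c _ q1.
by move=> /= /(le_trans (ler_norm _)) cN; rewrite (le_trans (xyc N))// lerD2l.
Qed.

(** The tail beyond [N] of the dominating series is exactly
    [2 * B * 2^-1 ^+ N]. *)
Lemma norm_limn_series_sub (v : R^nat) (B : R) N :
  (forall k, `|v k| <= B * 2^-1 ^+ k) ->
  `|limn (series v) - \sum_(0 <= k < N) v k| <= 2 * B * 2^-1 ^+ N.
Proof.
move=> vB.
have q1 : `|2^-1 : R| < 1 by rewrite gtr0_norm ?invr_gt0// invf_lt1// ltr1n.
have B0 : 0 <= B by have := vB 0%N; rewrite expr0 mulr1; exact: le_trans.
have cv : cvgn (series v).
  apply: normed_cvg; apply: (@series_le_cvg _ _ (geometric B 2^-1)) => //.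
  - by move=> k /=.
  - by move=> k; rewrite /= mulr_ge0// exprn_ge0// invr_ge0.
  - exact: is_cvg_geometric_series.
have tail j : `|\sum_(0 <= k < N + j) v k - \sum_(0 <= k < N) v k| <=
    2 * B * (2^-1 ^+ N - 2^-1 ^+ (N + j)).
  elim: j => [|j IHj]; first by rewrite addn0 !subrr normr0 mulr0.
  rewrite addnS big_nat_recr//= addrAC (le_trans (ler_normD _ _))//.
  rewrite (le_trans (lerD IHj (vB _)))// exprS -subr_ge0.
  by set p := _ ^+ (N + j); set r := _ ^+ N; rewrite (_ : _ - _ = 0)//; field.
apply/ler_addgt0Pr => e e0.
have /cvgr_dist_le /(_ e e0) : series v @ \oo --> limn (series v) by [].
move=> [m _ /(_ (N + m)%N (leq_addl _ _))] /= le_e.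
rewrite -(subrKA (series v (N + m)%N)) addrC (le_trans (ler_normD _ _))//.
rewrite lerD// (le_trans (tail m))// ler_wpM2l ?mulr_ge0// gerBl.
by rewrite exprn_ge0// invr_ge0.
Qed.

Lemma norm_mx_limn_series_sub (m n : nat) (u : nat -> 'M[R]_(m, n)) (B : R) N :
  (forall k, `|u k| <= B * 2^-1 ^+ k) ->
  `|(\matrix_(i, j) limn (series (fun k => u k i j))) - \sum_(0 <= k < N) u k|
    <= 2 * B * 2^-1 ^+ N.
Proof.
move=> uB.
have B0 : 0 <= B by have := uB 0%N; rewrite expr0 mulr1; exact: le_trans.
apply/mx_norm_leP => [|i j].
  by rewrite !mulr_ge0// exprn_ge0// invr_ge0.
rewrite !mxE summxE; apply: norm_limn_series_sub => k.
by rewrite (le_trans _ (uB k))// le_mx_norm.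
Qed.

End GeometricSeries.

(** * Existence for linear differential equations *)

Section LinearODE.
Variable R : realType.

Lemma has_derive_on_expR (I : set R) (d c t : R) :
  has_derive_on I ((fun s => d * expR (c * s)) : R -> R^o) t
    (d * (c * expR (c * t))).
Proof.
apply: is_derive_has_derive_on.
have h : is_derive t 1 (fun s : R => c * s) c.
  by apply: is_derive_eq; rewrite /GRing.scale /= mulr1.
have := is_derive1_comp (is_derive_expR (c * t)) h.
by rewrite mulrC => he; exact: (@is_deriveZ _ _ _ _ d).
Qed.

Lemma has_derive_on_lipschitz (m n : nat) (f f' : R -> 'M[R]_(m, n))
    (a b K : R) :
  (forall s, `[a, b]%classic s -> has_derive_on `[a, b] f s (f' s)) ->
  (forall s, `[a, b]%classic s -> `|f' s| <= K) ->
  forall s t, `[a, b]%classic s -> `[a, b]%classic t ->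
    `|f s - f t| <= K * `|s - t|.
Proof.
move=> ff' f'K.
suff h s t : `[a, b]%classic s -> `[a, b]%classic t -> s <= t ->
    `|f t - f s| <= K * `|t - s|.
  move=> s t sab tab; have [st|/ltW ts] := leP s t; last exact: h.
  by rewrite distrC (distrC s); exact: h.
rewrite /= !in_itv /= => /andP[as_ _] /andP[_ tb] st.
have stab : `[s, t] `<=` `[a, b].
  by apply: subset_itvScc; rewrite bnd_simp.
rewrite ger0_norm ?subr_ge0// mulrBr.
apply: (@has_derive_on_norm_le _ _ _ f f' (fun x => K * x) (fun=> K)) => //.
- by move=> x xst; apply: has_derive_on_sub (ff' x (stab _ xst)).
- move=> x _; apply: is_derive_has_derive_on.
  by apply: is_derive_eq; rewrite /GRing.scale /= mulr1.
- by move=> x /stab; exact: f'K.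
Qed.

Definition mx_primitive (m n : nat) (F : R -> 'M[R]_(m, n)) (t : R) :=
  \matrix_(i, j) primitive (fun s => F s i j) t.

Variables (n m : nat) (I : set R) (A : R -> 'M[R]_n) (X0 : 'M[R]_(n, m)).
Hypotheses (itvI : is_interval I) (I0 : I 0).
Hypothesis A_cont : forall t, I t -> A @ within I (nbhs t) --> A t.

Lemma has_derive_on_mx_primitive p q (F : R -> 'M[R]_(p, q)) :
  (forall t, I t -> F @ within I (nbhs t) --> F t) ->
  forall t, I t -> has_derive_on I (mx_primitive F) t (F t).
Proof.
move=> cF t It; apply/has_derive_on_mxP => i j.
under [fun _ => _]eq_fun do rewrite mxE.
apply: has_derive_on_primitive => // s /cF /cvg_mxP; exact.
Qed.

Lemma mx_primitive0 p q (F : R -> 'M[R]_(p, q)) : mx_primitive F 0 = 0.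
Proof. by apply/matrixP => i j; rewrite !mxE primitive0. Qed.

(** The k-th term of Picard's series, that is the difference of two successive
    Picard iterates. *)
Fixpoint picard_term (k : nat) : R -> 'M[R]_(n, m) :=
  if k is k'.+1 then mx_primitive (fun s => A s *m picard_term k' s)
  else fun=> X0.

Lemma has_derive_on_picard_term k t : I t ->
  has_derive_on I (picard_term k.+1) t (A t *m picard_term k t).
Proof.
move: t; elim: k => [|k IHk] t It; apply: has_derive_on_mx_primitive => // s Is.
  by apply: cvg_mulmx; [exact: A_cont|exact: cvg_cst].
apply: cvg_mulmx; first exact: A_cont.
exact: has_derive_on_cont (IHk _ Is).
Qed.

(** Differentiating shifts the series by one term: the partial sums solve the
    equation up to one step of the approximation. *)
Lemma has_derive_on_picard_partial_sum N t : I t ->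
  has_derive_on I (fun s => \sum_(0 <= k < N.+1) picard_term k s) t
    (A t *m \sum_(0 <= k < N) picard_term k t).
Proof.
move=> It; have -> : (fun s => \sum_(0 <= k < N.+1) picard_term k s) =
    (fun s => X0 + \sum_(0 <= k < N) picard_term k.+1 s).
  by apply/funext => s; rewrite big_nat_recl.
rewrite mulmx_sumr; apply: has_derive_on_cstD.
by apply: has_derive_on_sum => k; exact: has_derive_on_picard_term.
Qed.

Section Segment.
Variables (a b M : R).
Hypotheses (a0 : a <= 0) (b0 : 0 <= b) (M0 : 0 <= M).
Hypothesis abI : `[a, b] `<=` I.
Hypothesis A_le : forall s, `[a, b]%classic s -> n%:R * `|A s| <= M.

Lemma norm_mulmx_le p (X : 'M[R]_(n, p)) s : `[a, b]%classic s ->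
  `|A s *m X| <= M * `|X|.
Proof.
by move=> sab; rewrite (le_trans (mx_norm_mulmx _ _))// ler_wpM2r// A_le.
Qed.

(** By induction: if term [k] is at most [D expR (2 M |s|)], the next one has a
    derivative bounded by [M D expR (2 M |s|)], which is the derivative of
    [D / 2 * expR (2 M s)] for [s >= 0] and that of
    [- D / 2 * expR (- 2 M s)] for [s <= 0].  The rate [2 M] of the exponential
    is chosen to gain the factor 1/2. *)
Lemma picard_term_le_exp k t : `[a, b]%classic t ->
  `|picard_term k t| <= `|X0| * 2^-1 ^+ k * expR (2 * M * `|t|).
Proof.
elim: k t => [|k IHk] t tab.
  by rewrite expr0 mulr1 ler_peMr// -expR0 ler_expR !mulr_ge0.
set D := `|X0| * 2^-1 ^+ k in IHk *.
have D0 : 0 <= D by rewrite mulr_ge0// exprn_ge0// invr_ge0.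
rewrite exprS mulrCA -/D.
have sub0 u v : `[a, b]%classic u -> `[a, b]%classic v -> `[u, v] `<=` `[a, b].
  rewrite /= !in_itv /= => /andP[au _] /andP[_ vb].
  by apply: subset_itvScc; rewrite bnd_simp.
have zab : `[a, b]%classic 0 by rewrite /= in_itv /= a0.
have dP u v s : `[a, b]%classic u -> `[a, b]%classic v -> `[u, v]%classic s ->
    has_derive_on `[u, v] (picard_term k.+1) s (A s *m picard_term k s).
  move=> uab vab suv; have sab := sub0 u v uab vab s suv.
  apply: (@has_derive_on_sub _ _ I); last first.
    by apply: has_derive_on_picard_term; exact: abI.
  by move=> x /(sub0 u v uab vab)/abI.
have P0 : picard_term k.+1 0 = 0 by exact: mx_primitive0.
have Dexp c s : `[a, b]%classic s -> 2 * M * `|s| = c * s ->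
    `|A s *m picard_term k s| <= 2^-1 * D * (2 * M * expR (c * s)).
  move=> sab sc; rewrite (le_trans (norm_mulmx_le _ sab))//.
  rewrite (_ : 2^-1 * D * _ = M * (D * expR (c * s))); last by field.
  by rewrite ler_wpM2l// -sc IHk.
have [t0|/ltW t0] := leP 0 t.
- have := @has_derive_on_norm_le _ _ _ (picard_term k.+1)
    (fun s => A s *m picard_term k s)
    (fun s => 2^-1 * D * expR (2 * M * s))
    (fun s => 2^-1 * D * (2 * M * expR (2 * M * s))) 0 t t0.
  rewrite P0 subr0 ger0_norm// => h; apply: (le_trans (h _ _ _)).
  + by move=> s; exact: dP.
  + by move=> s _; exact: has_derive_on_expR.
  + move=> s s0t; apply: Dexp; first exact: sub0 s0t.
    by rewrite ger0_norm//; move: s0t; rewrite /= in_itv /= => /andP[].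
  + by rewrite gerBl !mulr_ge0// ?invr_ge0// expR_ge0.
- have := @has_derive_on_norm_le _ _ _ (picard_term k.+1)
    (fun s => A s *m picard_term k s)
    (fun s => - (2^-1 * D) * expR (- (2 * M) * s))
    (fun s => - (2^-1 * D) * (- (2 * M) * expR (- (2 * M) * s))) t 0 t0.
  rewrite P0 sub0r normrN ler0_norm// => h; apply: (le_trans (h _ _ _)).
  + by move=> s; exact: dP.
  + by move=> s _; exact: has_derive_on_expR.
  + move=> s s0t; rewrite mulNr mulNr mulrN opprK -mulNr.
    apply: Dexp; first exact: sub0 s0t.
    rewrite ler0_norm ?mulNr ?mulrN//.
    by move: s0t; rewrite /= in_itv /= => /andP[].
  + rewrite !mulNr opprK addrC mulrN gerBl.
    by rewrite !mulr_ge0// ?invr_ge0// expR_ge0.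
Qed.

Let B := `|X0| * expR (2 * M * (b - a)).

Lemma picard_term_le k t : `[a, b]%classic t ->
  `|picard_term k t| <= B * 2^-1 ^+ k.
Proof.
move=> tab; rewrite (le_trans (picard_term_le_exp k tab))// /B mulrAC.
rewrite ler_wpM2r ?exprn_ge0 ?invr_ge0// ler_wpM2l// ler_expR.
rewrite ler_wpM2l ?mulr_ge0//.
move: tab; rewrite /= in_itv /= => /andP[ta tb]; rewrite ler_norml.
by rewrite opprB (le_trans _ ta) ?gerBl//= (le_trans tb)// lerDl oppr_ge0.
Qed.

End Segment.

(** The sum is taken entry by entry, where completeness of the reals applies. *)
Definition picard_sum (t : R) : 'M[R]_(n, m) :=
  \matrix_(i, j) limn (series (fun k => picard_term k t i j)).

Lemma segment_coef_bound (a b : R) : a <= b -> `[a, b] `<=` I ->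
  exists2 M, 0 <= M & forall s, `[a, b]%classic s -> n%:R * `|A s| <= M.
Proof.
move=> ab abI; have [|c cab cM] := @EVT_max R (fun s => n%:R * `|A s|) _ _ ab.
  apply/subspace_continuousP => x xab.
  have cA : A @ within `[a, b] (nbhs x) --> A x.
    apply: cvg_trans (A_cont (abI _ xab)).
    by apply: cvg_fmap2; exact: within_subset.
  by apply: cvgM; [exact: cvg_cst|exact: cvg_norm].
exists (n%:R * `|A c|); first by rewrite mulr_ge0.
by move=> s sab; exact: cM.
Qed.

Lemma picard_sum_approx (a b : R) :
  a <= 0 -> 0 <= b -> `[a, b] `<=` I ->
  exists M B, [/\ 0 <= M, 0 <= B,
    forall p (X : 'M[R]_(n, p)) s, `[a, b]%classic s ->
      `|A s *m X| <= M * `|X| &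
    forall N s, `[a, b]%classic s ->
      `|picard_sum s - \sum_(0 <= k < N) picard_term k s| <= B * 2^-1 ^+ N].
Proof.
move=> a0 b0 abI; have [M M0 MA] := segment_coef_bound (le_trans a0 b0) abI.
exists M, (2 * (`|X0| * expR (2 * M * (b - a)))); split => //.
- by move=> p X s; exact: norm_mulmx_le.
- by move=> N s sab; apply: norm_mx_limn_series_sub => k; exact: picard_term_le.
Qed.

(** The partial sums are Lipschitz on a segment around [t] with a common
    constant, hence so is their limit. *)
Lemma picard_sum_cont t : I t ->
  picard_sum @ within I (nbhs t) --> picard_sum t.
Proof.
move=> It.
have [a [b [/andP[a0 b0] abI tab]]] := interval_segment_nbhs itvI I0 It.
have tabt : `[a, b]%classic t.
  by move: tab; rewrite near_withinE => /nbhs_singleton; exact.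
have [M [B [M0 B0 MA SB]]] := picard_sum_approx a0 b0 abI.
have SK N s : `[a, b]%classic s ->
    `|\sum_(0 <= k < N) picard_term k s| <= 2 * B.
  move=> sab; rewrite -(subKr (picard_sum s) (\sum_(0 <= k < N) _)).
  rewrite (le_trans (ler_normB _ _))// [2 * B]mulr_natl mulr2n lerD//.
    by have := SB 0%N s sab; rewrite big_geq// subr0 expr0 mulr1.
  rewrite (le_trans (SB N s sab))// ler_piMr// exprn_ile1 ?invr_ge0//.
  by rewrite invf_le1// ler1n.
pose K := M * (2 * B).
have K0 : 0 <= K by rewrite !mulr_ge0.
have lipS N s : `[a, b]%classic s ->
    `|\sum_(0 <= k < N.+1) picard_term k t -
      \sum_(0 <= k < N.+1) picard_term k s|
      <= K * `|t - s|.
  move=> sab; apply: (@has_derive_on_lipschitz _ _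
    (fun x => \sum_(0 <= k < N.+1) picard_term k x)
    (fun x => A x *m \sum_(0 <= k < N) picard_term k x) a b) => // x xab.
    apply: (has_derive_on_sub abI).
    by apply: has_derive_on_picard_partial_sum; exact: abI.
  by rewrite (le_trans (MA _ _ _ xab))// ler_wpM2l// SK.
have lip s : `[a, b]%classic s ->
    `|picard_sum t - picard_sum s| <= K * `|t - s|.
  move=> sab; apply: (@ler_geometric_vanish _ _ _ B) => N.
  have := SB N.+1 t tabt; have := SB N.+1 s sab; have := lipS N s sab.
  set St := \sum_(_ <= _ < _) _; set Ss := \sum_(_ <= _ < _) picard_term _ s.
  move=> h1 h2 h3.
  have -> : picard_sum t - picard_sum s =
      (picard_sum t - St) + (St - Ss) - (picard_sum s - Ss).
    by rewrite subrKA opprB subrKA.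
  rewrite (le_trans (ler_normB _ _))//.
  rewrite (le_trans (lerD (ler_normD _ _) (lexx _)))//.
  rewrite exprS in h2 h3; move: h1 h2 h3; set p := _ ^+ N; lra.
apply/cvgrPdist_le => e e0.
have eK : 0 < e / (K + 1) by rewrite divr_gt0// ltr_wpDl.
have near_t : \forall s \near within I (nbhs t), `|t - s| <= e / (K + 1).
  rewrite near_withinE; near=> s => _; near: s.
  by apply: cvgr_dist_le eK; exact: cvg_id.
apply: filterS2 tab near_t => s sab st.
rewrite (le_trans (lip s sab))// (le_trans (ler_wpM2l K0 st))//.
by rewrite mulrCA ler_piMr ?(ltW e0)// ler_pdivrMr ?ltr_wpDl// mul1r lerDl.
Unshelve. all: by end_near. Qed.

(** The right-hand side and the partial sum of rank [N.+1] agree at 0, and their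
    derivatives differ by [A] times the remainder of rank [N]; so they differ by
    [O(2^-N)], as do the partial sum and [picard_sum]. *)
Lemma picard_sum_fixpoint t : I t ->
  picard_sum t = X0 + mx_primitive (fun s => A s *m picard_sum s) t.
Proof.
move=> It.
have [a [b [/andP[a0 b0] abI tab]]] := interval_segment_nbhs itvI I0 It.
have tabt : `[a, b]%classic t.
  by move: tab; rewrite near_withinE => /nbhs_singleton; exact.
have zab : `[a, b]%classic 0 by rewrite /= in_itv /= a0.
have [M [B [M0 B0 MA SB]]] := picard_sum_approx a0 b0 abI.
pose G s := X0 + mx_primitive (fun s => A s *m picard_sum s) s.
have dG s : I s -> has_derive_on I G s (A s *m picard_sum s).
  move=> Is; apply: has_derive_on_cstD.
  apply: has_derive_on_mx_primitive => // x Ix.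
  by apply: cvg_mulmx; [exact: A_cont|exact: picard_sum_cont].
have GS N : `|G t - \sum_(0 <= k < N.+1) picard_term k t| <=
    M * (B * 2^-1 ^+ N) * `|t|.
  have := @has_derive_on_lipschitz _ _
    (fun s => G s - \sum_(0 <= k < N.+1) picard_term k s)
    (fun s => A s *m (picard_sum s - \sum_(0 <= k < N) picard_term k s)) a b
    (M * (B * 2^-1 ^+ N)) _ _ t 0 tabt zab.
  have -> : G 0 - \sum_(0 <= k < N.+1) picard_term k 0 = 0.
    rewrite /G mx_primitive0 addr0 big_nat_recl//= big1 ?addr0 ?subrr// => k _.
    exact: mx_primitive0.
  rewrite !subr0; apply.
  - move=> s sab; rewrite mulmxBr; apply: (has_derive_on_sub abI).
    apply: has_derive_onB; first by apply: dG; exact: abI.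
    by apply: has_derive_on_picard_partial_sum; exact: abI.
  - by move=> s sab; rewrite (le_trans (MA _ _ _ sab))// ler_wpM2l// SB.
apply/eqP; rewrite -subr_eq0 -normr_le0 -/(G t).
apply: (@ler_geometric_vanish _ _ _ (B + M * B * `|t|)) => N; rewrite add0r.
have := SB N.+1 t tabt; have := GS N.
set S := \sum_(_ <= _ < _) _ => h1 h2.
rewrite -(subrKA S) (le_trans (ler_normD _ _))// (distrC S) mulrDl lerD//.
  rewrite (le_trans h2)// ler_wpM2l// exprS ler_piMl ?exprn_ge0 ?invr_ge0//.
  by rewrite invf_le1// ler1n.
by rewrite (le_trans h1)// le_eqVlt; apply/orP; left; apply/eqP; ring.
Qed.

Lemma linear_ode_exists : exists X : R -> 'M[R]_(n, m),
  X 0 = X0 /\ forall t, I t -> has_derive_on I X t (A t *m X t).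
Proof.
exists picard_sum; split.
  by rewrite picard_sum_fixpoint// mx_primitive0 addr0.
move=> t It; apply: has_derive_on_eq picard_sum_fixpoint _ => //.
apply: has_derive_on_cstD.
apply: has_derive_on_mx_primitive => // s Is.
by apply: cvg_mulmx; [exact: A_cont|exact: picard_sum_cont].
Qed.

End LinearODE.

(** * The harmonic oscillator *)

Lemma has_derive_on_cos (R : realType) (I : set R) (k t : R) :
  has_derive_on I ((fun s => cos (k * s)) : R -> R^o) t (- k * sin (k * t)).
Proof.
apply: is_derive_has_derive_on.
have h : is_derive t 1 (fun s : R => k * s) k.
  by apply: is_derive_eq; rewrite /GRing.scale /= mulr1.
rewrite mulNr -mulrN mulrC.
exact: (is_derive1_comp (is_derive_cos (k * t)) h).
Qed.

Lemma has_derive_on_sin (R : realType) (I : set R) (k t : R) :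
  has_derive_on I ((fun s => sin (k * s)) : R -> R^o) t (k * cos (k * t)).
Proof.
apply: is_derive_has_derive_on.
have h : is_derive t 1 (fun s : R => k * s) k.
  by apply: is_derive_eq; rewrite /GRing.scale /= mulr1.
by rewrite mulrC; exact: (is_derive1_comp (is_derive_sin (k * t)) h).
Qed.

Arguments has_derive_on_cos {R} I k t.
Arguments has_derive_on_sin {R} I k t.

Section Oscillator.
Variables (R : realType) (m n : nat) (I : set R) (k : R).
Hypotheses (itvI : is_interval I) (I0 : I 0) (k_gt0 : 0 < k).

(** With [z = y' / k], the vector [(y, z)] turned back by the angle [k t] has
    zero derivative, so it stays equal to [(y 0, z 0)]; turning it forward again
    gives the formula. *)
Lemma harmonic_oscillator_unique (y y1 : R -> 'M[R]_(m, n)) :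
  (forall t, I t -> has_derive_on I y t (y1 t)) ->
  (forall t, I t -> has_derive_on I y1 t (- (k ^+ 2 *: y t))) ->
  forall t, I t ->
    y t = cos (k * t) *: y 0 + sin (k * t) *: (k^-1 *: y1 0).
Proof.
move=> dy dy1 t It.
have k0 : k != 0 by rewrite gt_eqF.
have kk : k^-1 * k ^+ 2 = k by rewrite expr2 mulKf.
pose z s := k^-1 *: y1 s.
have dz s : I s -> has_derive_on I z s (- (k *: y s)).
  move=> Is; have -> : - (k *: y s) = 0 *: y1 s + k^-1 *: - (k ^+ 2 *: y s).
    by rewrite scale0r add0r scalerN scalerA kk.
  by apply: has_derive_onZ (dy1 s Is); exact: (@has_derive_on_cst _ R^o).
have y1E s : y1 s = k *: z s by rewrite /z scalerA divff// scale1r.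
have z1 : cos (k * t) *: y t - sin (k * t) *: z t = y 0.
  have -> : y 0 = cos (k * 0) *: y 0 - sin (k * 0) *: z 0.
    by rewrite mulr0 cos0 sin0 scale1r scale0r subr0.
  apply: (has_derive_on_0_cst
    (f := fun s => cos (k * s) *: y s - sin (k * s) *: z s) itvI) => // s Is.
  have := has_derive_onB (has_derive_onZ (has_derive_on_cos I k s) (dy s Is))
    (has_derive_onZ (has_derive_on_sin I k s) (dz s Is)).
  congr (has_derive_on _ _ _ _); rewrite (y1E s); move: (z s) (y s) => zs ys.
  by apply/matrixP => i j; rewrite !mxE; ring.
have z2 : sin (k * t) *: y t + cos (k * t) *: z t = z 0.
  have -> : z 0 = sin (k * 0) *: y 0 + cos (k * 0) *: z 0.
    by rewrite mulr0 cos0 sin0 scale1r scale0r add0r.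
  apply: (has_derive_on_0_cst
    (f := fun s => sin (k * s) *: y s + cos (k * s) *: z s) itvI) => // s Is.
  have := has_derive_onD (has_derive_onZ (has_derive_on_sin I k s) (dy s Is))
    (has_derive_onZ (has_derive_on_cos I k s) (dz s Is)).
  congr (has_derive_on _ _ _ _); rewrite (y1E s); move: (z s) (y s) => zs ys.
  by apply/matrixP => i j; rewrite !mxE; ring.
rewrite -[k^-1 *: _]/(z 0) -z1 -z2 scalerBr scalerDr !scalerA addrACA.
rewrite [sin _ * cos _]mulrC addNr addr0 -scalerDl -!expr2.
by rewrite cos2Dsin2 scale1r.
Qed.

End Oscillator.

(** * The rotation with a given angular velocity *)

Section Rotation.
Variable R : realType.
Implicit Types (u v : 'cV[R]_3).

Lemma skew_mxN u : skew_mx (- u) = - skew_mx u.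
Proof. by apply/matrixP => i j; rewrite !mxE; ring. Qed.

Lemma cvg_skew_mx (T : Type) (F : set_system T) {FF : Filter F}
    (f : T -> 'cV[R]_3) u :
  f @ F --> u -> skew_mx (f x) @[x --> F] --> skew_mx u.
Proof.
move=> /cvg_mxP fu; apply/cvg_mxP => i j; rewrite !mxE.
under eq_fun do rewrite !mxE.
by apply: cvgB; apply: cvgM => //; exact: cvg_cst.
Qed.

Lemma has_derive_on_skew_mx (I : set R) (w : R -> 'cV[R]_3) t w' :
  has_derive_on I w t w' ->
  has_derive_on I (fun s => skew_mx (w s)) t (skew_mx w').
Proof.
move=> /cvg_skew_mx; apply: cvg_trans; apply: near_eq_cvg.
by apply: filterE => s; apply/matrixP => i j; rewrite !mxE; ring.
Qed.

Variables (I : set R) (w : R -> 'cV[R]_3).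
Hypotheses (itvI : is_interval I) (I0 : I 0).
Hypothesis properI : forall t, I t -> ProperFilter (within I t^').
Hypothesis w_derivable : forall t, I t -> derivable_on I w t.

Let Q := rotation I (fun s => - w s).

(** Existence of a solution rules out the default value in the definition of
    [rotation]. *)
Lemma rotationP : Q 0 = 1%:M /\
  forall t, I t -> has_derive_on I Q t (- skew_mx (w t) *m Q t).
Proof.
have [Q0 dQ] : is_rotation I (fun s => - w s) Q.
  apply: (@xgetPex _ (fun=> 0) [set Q | is_rotation I (fun s => - w s) Q]).
  have [|X [X0 dX]] :=
    @linear_ode_exists R 3 3 I (fun s => skew_mx (- w s)) 1%:M itvI I0.
    move=> t It; apply: cvg_skew_mx; apply: cvgN.
    exact: has_derive_on_cont (w_derivable It).
  exists X; split => // t It.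
  by apply: has_derive_on_val (dX t It); exact: properI.
split=> // t It; have [dQt QtE] := dQ t It.
by rewrite -skew_mxN -QtE; exact: dQt.
Qed.

(** The derivative of [Q^T Q] is [Q^T (W - W) Q = 0]. *)
Lemma rotation_orthogonal t : I t -> (Q t)^T *m Q t = 1%:M.
Proof.
move=> It; have [Q0 dQ] := rotationP.
have -> : 1%:M = (Q 0)^T *m Q 0 by rewrite Q0 mulmx1 trmx1.
apply: (has_derive_on_0_cst (f := fun s => (Q s)^T *m Q s) itvI) => // s Is.
have := has_derive_on_mulmx (has_derive_on_tr (dQ s Is)) (dQ s Is).
congr (has_derive_on _ _ _ _).
by rewrite trmx_mul linearN /= skew_mx_tr opprK mulNmx mulmxN mulmxA subrr.
Qed.

End Rotation.

(** * The Cauchy problem in the rotating frame *)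

Theorem mainTheorem18 (R : realType) (I : set R) (w : R -> 'cV[R]_3)
    (wstar : R) (r0 v0 : 'cV[R]_3)
    (I_interval : is_interval I) (I_0 : I 0) (I_nondegenerate : I <> [set 0])
    (w_derivable : forall t, I t -> derivable_on I w t)
    (wstar_gt0 : 0 < wstar) (r : R -> 'cV[R]_3) :
  cauchy_solution I w wstar r0 v0 r <->
  forall t, I t ->
    r t = rotation_tensor I (fun s => - w s)
            (fun s => cos (wstar * s) *: r0
                      + sin (wstar * s) *: (wstar^-1 *: (v0 + crossv (w 0) r0)))
            t.
Proof.
have properI t : I t -> ProperFilter (within I t^').
  move=> It; apply: dnbhs_within_proper => //; apply: contrapT => nu.
  apply: I_nondegenerate; apply/seteqP; split=> [s Is|s /= ->//].
  have eq_t x : I x -> x = t.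
    by move=> Ix; apply/eqP/negPn/negP => xt; apply: nu; exists x.
  by rewrite /= (eq_t s Is) (eq_t 0 I_0).
have valI (f : R -> 'cV[R]_3) t l : I t -> has_derive_on I f t l ->
    derivable_on I f t /\ derive_on I f t = l.
  by move=> It; apply: has_derive_on_val; exact: properI.
set Q := rotation I (fun s => - w s).
have [Q0 dQ] := rotationP I_interval I_0 properI w_derivable.
rewrite -/Q in Q0 dQ.
have QTQ := rotation_orthogonal I_interval I_0 properI w_derivable.
rewrite -/Q in QTQ.
pose W t := skew_mx (w t); pose W' t := skew_mx (derive_on I w t).
have dW t : I t -> has_derive_on I W t (W' t).
  by move=> It; apply: has_derive_on_skew_mx; exact: w_derivable.
rewrite /rotation_tensor -/Q; split.
- move=> [dr dr' eqn r_0 r'_0] t It.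
  pose r1 := derive_on I r.
  have {}dr s : I s -> has_derive_on I r s (r1 s) by move=> /dr.
  have {}dr' s : I s -> has_derive_on I r1 s (derive_on I r1 s) by move=> /dr'.
  (* [y] is the motion seen from the frame at rest and [y1] its velocity. *)
  pose y s := (Q s)^T *m r s; pose y1 s := (Q s)^T *m (r1 s + W s *m r s).
  have dQT s : I s -> has_derive_on I (fun x => (Q x)^T) s ((Q s)^T *m W s).
    move=> Is; have := has_derive_on_tr (dQ s Is).
    by rewrite trmx_mul linearN /= skew_mx_tr opprK.
  have dy s : I s -> has_derive_on I y s (y1 s).
    move=> Is; have := has_derive_on_mulmx (dQT s Is) (dr s Is).
    by rewrite /y1 mulmxDr mulmxA [X in has_derive_on _ _ _ X]addrC.
  have dy1 s : I s -> has_derive_on I y1 s (- (wstar ^+ 2 *: y s)).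
    move=> Is; have := has_derive_on_mulmx (dQT s Is)
      (has_derive_onD (dr' s Is) (has_derive_on_mulmx (dW s Is) (dr s Is))).
    congr (has_derive_on _ _ _ _).
    rewrite -mulmxA -mulmxDr scalemxAr -mulmxN; congr (_ *m _).
    have := eqn s Is; rewrite -!skew_mxE -/r1 -/(W s) -/(W' s) => e.
    apply/eqP; rewrite -subr_eq0 opprK -e mulmxDr scaler_nat mulr2n; apply/eqP.
    rewrite -!addrA; move: (derive_on _ _ _) (W s *m r1 s).
    move: (W s *m (W s *m r s)) (W' s *m r s) (_ *: _) => c d e' a b.
    by apply/colP => i; rewrite !mxE; ring.
  have QQT : Q t *m (Q t)^T = 1%:M by apply: mulmx1C; exact: QTQ.
  have <- : y t = cos (wstar * t) *: r0 +
      sin (wstar * t) *: (wstar^-1 *: (v0 + crossv (w 0) r0)).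
    rewrite (harmonic_oscillator_unique I_interval I_0 wstar_gt0 dy dy1 It).
    by rewrite /y /y1 Q0 trmx1 !mul1mx /r1 r'_0 r_0 skew_mxE.
  by rewrite /y mulmxA QQT mul1mx.
- set u := wstar^-1 *: _ => rE.
  (* [x] is the harmonic motion, and [r1], [r2] are the derivatives of [Q x]. *)
  pose x s := cos (wstar * s) *: r0 + sin (wstar * s) *: u.
  pose x1 s := (- wstar * sin (wstar * s)) *: r0 +
    (wstar * cos (wstar * s)) *: u.
  have dx s : has_derive_on I x s (x1 s).
    have := has_derive_onD
      (has_derive_onZ (has_derive_on_cos I wstar s) (has_derive_on_cst I r0 s))
      (has_derive_onZ (has_derive_on_sin I wstar s) (has_derive_on_cst I u s)).
    by rewrite !scaler0 !addr0.
  have dx1 s : has_derive_on I x1 s (- (wstar ^+ 2 *: x s)).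
    have dc (c : R) := has_derive_on_cst I (c : R^o) s.
    have := has_derive_onD
      (has_derive_onZ
        (has_derive_onZ (dc (- wstar)) (has_derive_on_sin I wstar s))
        (has_derive_on_cst I r0 s))
      (has_derive_onZ
        (has_derive_onZ (dc wstar) (has_derive_on_cos I wstar s))
        (has_derive_on_cst I u s)).
    congr (has_derive_on _ _ _ _); apply/colP => i.
    by rewrite !mxE /GRing.scale /=; ring.
  pose r1 s := - (W s *m r s) + Q s *m x1 s.
  have dr s : I s -> has_derive_on I r s (r1 s).
    move=> Is; apply: (has_derive_on_eq Is rE).
    have := has_derive_on_mulmx (dQ s Is) (dx s).
    by rewrite /r1 rE// -mulmxA mulNmx.
  have r'E s : I s -> derive_on I r s = r1 s.
    by move=> Is; have [] := valI _ _ _ Is (dr s Is).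
  pose r2 s := - (W' s *m r s + W s *m r1 s) +
    (- (W s *m (Q s *m x1 s)) - wstar ^+ 2 *: r s).
  have dr1 s : I s -> has_derive_on I (derive_on I r) s (r2 s).
    move=> Is; apply: (has_derive_on_eq Is r'E).
    have := has_derive_onD
      (has_derive_onN (has_derive_on_mulmx (dW s Is) (dr s Is)))
      (has_derive_on_mulmx (dQ s Is) (dx1 s)).
    by rewrite /r2 rE// -mulmxA mulNmx mulmxN -scalemxAr.
  split.
  + by move=> t It; have [] := valI _ _ _ It (dr t It).
  + by move=> t It; have [] := valI _ _ _ It (dr1 t It).
  + move=> t It; have [_ ->] := valI _ _ _ It (dr1 t It).
    rewrite r'E// -!skew_mxE -/(W t) -/(W' t) /r2.
    have -> : Q t *m x1 t = r1 t + W t *m r t by rewrite /r1 addrAC addNr add0r.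
    rewrite [W t *m (r1 t + _)]mulmxDr.
    move: (W t *m r1 t) (W t *m (W t *m r t)) (W' t *m r t) (r t) => a b c d.
    by apply/colP => i; rewrite !mxE; ring.
  + by rewrite rE// Q0 mul1mx mulr0 cos0 sin0 scale1r scale0r addr0.
  + rewrite r'E// /r1 rE// Q0 !mul1mx /x1 mulr0 cos0 sin0 mulr0 !scale0r.
    rewrite mulr1 scale1r addr0 add0r.
    rewrite /u scalerA divff ?gt_eqF// scale1r skew_mxE.
    by rewrite addrC addrK.
Qed.
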